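(* Let $p$ be a prime and let $O$ be a complete discrete valuation ring with maximal ideal $\mathfrak m$, residue field $\kappa=O/\mathfrak m$ of characteristic $p$, and field of fractions $K$ of characteristic $0$. Let $X$ be a finite set, let $x$ be a permutation of $X$ of order $p$, let $C_p=\langle x\rangle$, let $M=O^X$ be the corresponding permutation $OC_p$-lattice, and let $\mathcal F\subseteq X$ be the set of fixed points of $x$. Let $E\in\operatorname{End}_O(M)$ be an idempotent commuting with the action of $C_p$, set $L=EM$, and let $E[\mathcal F]$ denote the principal submatrix of the matrix of $E$ in the standard basis of $M$ on the rows and columns indexed by $\mathcal F$. Then $$\operatorname{tr}\bigl(x\mid K\otimes_O L\bigr)=\operatorname{rank}_{\kappa}\bigl(E[\mathcal F]\bmod \mathfrak m\bigr),$$ the integer on the right being regarded as an element of $K$.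
   Context: The permutation lattice $M=O^X$ is the free $O$-module with standard basis $(e_w)_{w\in X}$, on which $x$ acts $O$-linearly by $e_w\mapsto e_{x(w)}$. The image $L=EM$ is an $x$-stable direct summand of $M$, free of finite rank over $O$; $\operatorname{tr}(x\mid K\otimes_O L)$ is the trace of the $K$-linear endomorphism of $K\otimes_O L$ induced by $x$. $E[\mathcal F]\bmod\mathfrak m$ is the matrix over $\kappa$ obtained by reducing entries. An empty matrix has rank $0$. *)

(* Defs.v *)
(* MathComp, with the classical layer of MathComp-Analysis *)
From HB Require Import structures.
From mathcomp Require Import all_boot all_order all_algebra all_fingroup.
From mathcomp Require Import generic_quotient ring_quotient fraction.
From mathcomp Require Import boolp classical_sets.

Set Implicit Arguments.
Unset Strict Implicit.
Unset Printing Implicit Defensive.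

Import GRing.Theory.
Local Open Scope ring_scope.
Local Open Scope quotient_scope.

(* A commutative ring is local iff its nonunits are closed under addition; they
   then form the unique maximal ideal. *)
HB.mixin Record isLocalRing R of GRing.ComUnitRing R := {
  nonunitD : forall a b : R,
    a \isn't a GRing.unit -> b \isn't a GRing.unit ->
    a + b \isn't a GRing.unit
}.

#[short(type="localRingType")]
HB.structure Definition LocalRing := {R of GRing.ComUnitRing R & isLocalRing R}.

Definition max_ideal (R : localRingType) : {pred R} :=
  fun a => a \isn't a GRing.unit.
Arguments max_ideal : clear implicits.

Lemma max_idealE (R : localRingType) (a : R) :
  (a \in max_ideal R) = (a \isn't a GRing.unit).
Proof. by []. Qed.

Lemma max_ideal_idealr_closed (R : localRingType) : idealr_closed (max_ideal R).
Proof.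
split; rewrite ?max_idealE ?unitr0 ?unitr1 // => a u v.
rewrite !max_idealE => nu nv; apply: nonunitD => //.
by apply: contraNN nu; rewrite unitrM => /andP[].
Qed.

HB.instance Definition _ (R : localRingType) :=
  isIdealr.Build R (max_ideal R) (max_ideal_idealr_closed R).

Definition residue_field (R : localRingType) : Type :=
  {ideal_quot (max_ideal R)}.

HB.instance Definition _ (R : localRingType) :=
  GRing.ComNzRing.on (residue_field R).
HB.instance Definition _ (R : localRingType) :=
  EqQuotient.on (residue_field R).

Definition residue (R : localRingType) (a : R) : residue_field R := \pi a.

Section ResidueField.
Variable R : localRingType.
Implicit Types (a : R) (q : residue_field R).

Lemma residueK q : residue (repr q) = q.
Proof. by rewrite /residue reprK. Qed.

Lemma residue1 : residue (1 : R) = 1.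
Proof. exact: pi_oner. Qed.

Lemma residueM a b : residue (a * b) = residue a * residue b.
Proof. exact: (@Quotient.pi_mul _ (max_ideal R : idealr R)). Qed.

Lemma residueB a b : residue (a - b) = residue a - residue b.
Proof.
rewrite [LHS](@Quotient.pi_add _ (max_ideal R : zmodClosed R)).
by rewrite (@Quotient.pi_opp _ (max_ideal R : zmodClosed R)).
Qed.

Lemma residue_eq0 a : (residue a == 0) = (a \in max_ideal R).
Proof.
have <- : residue (0 : R) = 0 by have := residueB 0 0; rewrite subr0 subrr.
by rewrite -Quotient.idealrBE subr0.
Qed.

Definition residue_inv q : residue_field R :=
  if q == 0 then 0 else residue (repr q)^-1.

Lemma residue_mulVf q : q != 0 -> residue_inv q * q = 1.
Proof.
rewrite /residue_inv => q0; rewrite (negPf q0) -{2}(residueK q) -residueM.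
have uq : repr q \is a GRing.unit.
  apply: negbNE; apply: contraNN q0.
  by rewrite -max_idealE -residue_eq0 residueK.
by rewrite mulVr // residue1.
Qed.

Lemma residue_invr0 : residue_inv 0 = 0.
Proof. by rewrite /residue_inv eqxx. Qed.

HB.instance Definition _ := GRing.ComNzRing_isField.Build (residue_field R)
  residue_mulVf residue_invr0.

HB.instance Definition _ :=
  GRing.isZmodMorphism.Build R (residue_field R) (@residue R) residueB.
HB.instance Definition _ :=
  GRing.isMonoidMorphism.Build R (residue_field R) (@residue R)
    (residue1, residueM).

End ResidueField.

Definition is_ideal (R : comNzRingType) (I : set R) : Prop :=
  [/\ I 0, forall a b, I a -> I b -> I (a + b) & forall r a, I a -> I (r * a)].

HB.mixin Record isDVR R of LocalRing R & GRing.IntegralDomain R := {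
  ideal_principal : forall I : set R, is_ideal I ->
    exists a : R, forall b, I b <-> exists r, b = r * a;
  not_a_field : exists a : R, a != 0 /\ a \isn't a GRing.unit
}.

#[short(type="dvrType")]
HB.structure Definition DVR :=
  {R of GRing.IntegralDomain R & isLocalRing R & isDVR R}.

Definition max_ideal_exp (R : localRingType) (n : nat) : set R :=
  [set a | exists k (r : 'I_k -> R) (m : 'I_k -> 'I_n -> R),
    (forall i j, m i j \in max_ideal R) /\
    a = \sum_i r i * \prod_j m i j]%classic.

(* Every Cauchy sequence for the adic topology of the maximal ideal converges;
   in a DVR the topology is separated by Krull's intersection theorem. *)
HB.mixin Record isAdicComplete R of LocalRing R := {
  adic_complete : forall u : nat -> R,
    (forall n, exists N, forall i j, (N <= i)%N -> (N <= j)%N ->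
      max_ideal_exp n (u i - u j)) ->
    exists l : R, forall n, exists N, forall i, (N <= i)%N ->
      max_ideal_exp n (u i - l)
}.

#[short(type="completeDVRType")]
HB.structure Definition CompleteDVR := {R of DVR R & isAdicComplete R}.

(* The image of a linear map, as a submodule of its codomain. *)
Section LinImage.
Variables (R : nzRingType) (U V : lmodType R) (f : {linear U -> V}).

Definition lin_image_pred : {pred V} := [pred v | `[< exists u, v = f u >]].

Lemma lin_image_submod_closed : submod_closed lin_image_pred.
Proof.
split=> [|a _ _ /asboolP[u ->] /asboolP[v ->]]; apply/asboolP.
  by exists 0; rewrite linear0.
by exists (a *: u + v); rewrite linearP.
Qed.

HB.instance Definition _ :=
  GRing.isSubmodClosed.Build R V lin_image_pred lin_image_submod_closed.

Record lin_image : Type := LinImage {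
  lin_image_val :> V; _ : lin_image_val \in lin_image_pred }.

HB.instance Definition _ := [isSub for lin_image_val].
HB.instance Definition _ := [Choice of lin_image by <:].
HB.instance Definition _ := [SubChoice_isSubLmodule of lin_image by <:].

End LinImage.

(* The restriction of f to the image of E, when f commutes with E. *)
Section LinImageRestr.
Variables (R : nzRingType) (V : lmodType R) (E f : {linear V -> V}).
Hypothesis Ef : forall v, E (f v) = f (E v).

Lemma lin_image_restr_subproof (v : lin_image E) :
  f (val v) \in lin_image_pred E.
Proof.
by have /asboolP[u ->] := valP v; apply/asboolP; exists (f u); rewrite Ef.
Qed.

Definition lin_image_restr (v : lin_image E) : lin_image E :=
  LinImage (lin_image_restr_subproof v).

Lemma lin_image_restr_linear : linear lin_image_restr.
Proof. by move=> a u v; apply: val_inj; rewrite /= linearP. Qed.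

HB.instance Definition _ := GRing.isLinear.Build R _ _ _ lin_image_restr
  lin_image_restr_linear.

End LinImageRestr.

(* The tensor product K (x)_R L, for K viewed as an R-algebra through phi: formal
   sums of pairs (k, v), modulo the congruence generated by the bilinearity
   relations. *)
Section BaseChange.
Variables (R K : comNzRingType) (phi : {rmorphism R -> K}) (L : lmodType R).
Implicit Types s t u : seq (K * L).

Inductive tens_rel : seq (K * L) -> seq (K * L) -> Prop :=
| tens_refl s : tens_rel s s
| tens_sym s t : tens_rel s t -> tens_rel t s
| tens_trans s t u : tens_rel s t -> tens_rel t u -> tens_rel s u
| tens_cat s s' t t' :
    tens_rel s s' -> tens_rel t t' -> tens_rel (s ++ t) (s' ++ t')
| tens_catC s t : tens_rel (s ++ t) (t ++ s)
| tens_Dl k k' v : tens_rel [:: (k + k', v)] [:: (k, v); (k', v)]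
| tens_Dr k v v' : tens_rel [:: (k, v + v')] [:: (k, v); (k, v')]
| tens_0l v : tens_rel [:: (0, v)] [::]
| tens_0r k : tens_rel [:: (k, 0)] [::]
| tens_Z k a v : tens_rel [:: (k * phi a, v)] [:: (k, a *: v)].

Definition tens_relb s t : bool := `[< tens_rel s t >].

Lemma tens_relb_equiv : equiv_class_of tens_relb.
Proof.
split=> [s|s t|t s u]; first exact/asboolP/tens_refl.
  by apply/asboolP/asboolP; apply: tens_sym.
by move=> /asboolP st /asboolP tu; apply/asboolP; apply: tens_trans st tu.
Qed.

Canonical tens_relb_equiv_rel := EquivRelPack tens_relb_equiv.
Canonical tens_relb_encModRel := defaultEncModRel tens_relb.

Definition base_change : Type := {eq_quot tens_relb}.
HB.instance Definition _ : EqQuotient _ tens_relb base_change :=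
  EqQuotient.on base_change.
HB.instance Definition _ := Choice.on base_change.

Definition tens_class s : base_change := \pi s.

Lemma tens_classP s t : tens_class s = tens_class t <-> tens_rel s t.
Proof.
split=> [/eqP|st]; first by rewrite /tens_class piE => /asboolP.
by apply/eqP; rewrite /tens_class piE; apply/asboolP.
Qed.

Lemma tens_repr s : tens_rel (repr (tens_class s)) s.
Proof. by apply/tens_classP; rewrite /tens_class reprK. Qed.

Lemma tens_class_repr (x : base_change) : tens_class (repr x) = x.
Proof. by rewrite /tens_class reprK. Qed.

Definition tens_scale k s := [seq (k * x.1, x.2) | x <- s].

Lemma tens_scale_rel k s t :
  tens_rel s t -> tens_rel (tens_scale k s) (tens_scale k t).
Proof.
elim=> {s t} /=.
- by move=> s; apply: tens_refl.
- by move=> s t _; apply: tens_sym.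
- by move=> s t u _ + _; apply: tens_trans.
- by move=> s s' t t' _ IHs _ IHt; rewrite /tens_scale !map_cat; apply: tens_cat.
- by move=> s t; rewrite /tens_scale !map_cat; apply: tens_catC.
- by move=> k1 k2 v; rewrite mulrDr; apply: tens_Dl.
- by move=> k1 v v'; apply: tens_Dr.
- by move=> v; rewrite mulr0; apply: tens_0l.
- by move=> k1; apply: tens_0r.
- by move=> k1 a v; rewrite mulrA; apply: tens_Z.
Qed.

Definition bc_zero : base_change := tens_class [::].
Definition bc_add (x y : base_change) := tens_class (repr x ++ repr y).
Definition bc_scale k (x : base_change) := tens_class (tens_scale k (repr x)).
Definition bc_opp (x : base_change) := bc_scale (-1) x.

Lemma bc_addE s t : bc_add (tens_class s) (tens_class t) = tens_class (s ++ t).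
Proof. by apply/tens_classP/tens_cat; apply: tens_repr. Qed.

Lemma bc_scaleE k s : bc_scale k (tens_class s) = tens_class (tens_scale k s).
Proof. exact/tens_classP/tens_scale_rel/tens_repr. Qed.

Lemma bc_ind (P : base_change -> Prop) :
  (forall s, P (tens_class s)) -> forall x, P x.
Proof. by move=> Ps x; rewrite -(tens_class_repr x). Qed.

Lemma bc_addA : associative bc_add.
Proof.
elim/bc_ind=> s; elim/bc_ind=> t; elim/bc_ind=> u.
by rewrite !bc_addE catA.
Qed.

Lemma bc_addC : commutative bc_add.
Proof.
elim/bc_ind=> s; elim/bc_ind=> t; rewrite !bc_addE.
exact/tens_classP/tens_catC.
Qed.

Lemma bc_add0 : left_id bc_zero bc_add.
Proof. by elim/bc_ind=> s; rewrite bc_addE. Qed.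

Lemma tens_scaleDl k k' s :
  tens_rel (tens_scale (k + k') s) (tens_scale k s ++ tens_scale k' s).
Proof.
elim: s => [|[k0 v] s IHs] /=; first exact: tens_refl.
rewrite mulrDl -cat1s.
apply: tens_trans (tens_cat (tens_Dl _ _ _) IHs) _.
set A := tens_scale k s; set B := tens_scale k' s.
have: tens_rel ([:: (k * k0, v)] ++ (([:: (k' * k0, v)] ++ A) ++ B))
               ([:: (k * k0, v)] ++ ((A ++ [:: (k' * k0, v)]) ++ B)).
  apply: tens_cat (tens_refl _) (tens_cat _ (tens_refl _)).
  exact: tens_catC.
by rewrite -!catA.
Qed.

Lemma bc_scaleDl x : {morph bc_scale^~ x : k k' / k + k' >-> bc_add k k'}.
Proof.
elim/bc_ind: x => s k k'; rewrite !bc_scaleE bc_addE.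
exact/tens_classP/tens_scaleDl.
Qed.

Lemma bc_scale1 : left_id 1 bc_scale.
Proof.
elim/bc_ind=> s; rewrite bc_scaleE; congr tens_class.
by elim: s => //= -[k v] s ->; rewrite mul1r.
Qed.

Lemma bc_scale0 x : bc_scale 0 x = bc_zero.
Proof.
elim/bc_ind: x => s; rewrite bc_scaleE; apply/tens_classP.
elim: s => [|[k v] s IHs] /=; first exact: tens_refl.
by rewrite mul0r -cat1s; apply: tens_cat (tens_0l v) IHs.
Qed.

Lemma bc_addN : left_inverse bc_zero bc_opp bc_add.
Proof.
by move=> x; rewrite /bc_opp -{2}(bc_scale1 x) -bc_scaleDl addNr bc_scale0.
Qed.

Lemma bc_scaleA k k' x : bc_scale k (bc_scale k' x) = bc_scale (k * k') x.
Proof.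
elim/bc_ind: x => s; rewrite !bc_scaleE; congr tens_class.
by rewrite /tens_scale -map_comp; apply: eq_map => -[k0 v] /=; rewrite mulrA.
Qed.

Lemma bc_scaleDr : right_distributive bc_scale bc_add.
Proof.
move=> k; elim/bc_ind=> s; elim/bc_ind=> t.
by rewrite !(bc_addE, bc_scaleE) /tens_scale map_cat.
Qed.

HB.instance Definition _ :=
  GRing.isZmodule.Build base_change bc_addA bc_addC bc_add0 bc_addN.
HB.instance Definition _ := GRing.Zmodule_isLmodule.Build K base_change
  bc_scaleA bc_scale1 bc_scaleDr bc_scaleDl.

Lemma tens_classD s t : tens_class (s ++ t) = tens_class s + tens_class t.
Proof. exact/esym/bc_addE. Qed.

Lemma tens_classZ k s : tens_class (tens_scale k s) = k *: tens_class s.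
Proof. exact/esym/bc_scaleE. Qed.

Definition tens (k : K) (v : L) : base_change := tens_class [:: (k, v)].

Lemma tens_classE s : tens_class s = \sum_(x <- s) tens x.1 x.2.
Proof.
elim: s => [|[k v] s IHs]; first by rewrite big_nil.
by rewrite big_cons -IHs -tens_classD.
Qed.

End BaseChange.

Section BaseChangeMap.
Variables (R K : comNzRingType) (phi : {rmorphism R -> K}).
Variables (L L' : lmodType R) (f : {linear L -> L'}).

Definition tens_map (s : seq (K * L)) := [seq (x.1, f x.2) | x <- s].

Lemma tens_map_rel s t :
  tens_rel phi s t -> tens_rel phi (tens_map s) (tens_map t).
Proof.
elim=> {s t} /=.
- by move=> s; apply: tens_refl.
- by move=> s t _; apply: tens_sym.
- by move=> s t u _ + _; apply: tens_trans.
- by move=> s s' t t' _ IHs _ IHt; rewrite /tens_map !map_cat; apply: tens_cat.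
- by move=> s t; rewrite /tens_map !map_cat; apply: tens_catC.
- by move=> k1 k2 v; apply: tens_Dl.
- by move=> k1 v v'; rewrite linearD; apply: tens_Dr.
- by move=> v; apply: tens_0l.
- by move=> k1; rewrite linear0; apply: tens_0r.
- by move=> k1 a v; rewrite linearZ; apply: tens_Z.
Qed.

Definition base_change_map (x : base_change phi L) : base_change phi L' :=
  tens_class phi (tens_map (repr x)).

Lemma base_change_map_class s :
  base_change_map (tens_class phi s) = tens_class phi (tens_map s).
Proof. exact/tens_classP/tens_map_rel/tens_repr. Qed.

Lemma base_change_map_tens k v :
  base_change_map (tens phi k v) = tens phi k (f v).
Proof. exact: base_change_map_class. Qed.

Lemma base_change_map_linear : linear base_change_map.
Proof.
move=> k; elim/bc_ind=> s; elim/bc_ind=> t.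
rewrite -tens_classZ -tens_classD !base_change_map_class -tens_classZ.
by rewrite -tens_classD /tens_map map_cat /tens_scale -!map_comp.
Qed.

HB.instance Definition _ := GRing.isLinear.Build K _ _ _ base_change_map
  base_change_map_linear.

End BaseChangeMap.
Arguments base_change_map {R K} phi {L L'} f x.

(* The trace of an endomorphism f of a K-module T is the trace of its matrix in
   some finite basis of T, and 0 if T has no finite basis. *)
Section Trace.
Variables (K : comNzRingType) (T : lmodType K).

Definition is_basis n (b : 'I_n -> T) : Prop :=
  forall v, exists! c : 'rV[K]_n, v = \sum_i c 0 i *: b i.

Definition lin_trace (f : {linear T -> T}) : K :=
  xget 0 [set t | exists n (b : 'I_n -> T) (A : 'M[K]_n),
    [/\ is_basis b, forall j, f (b j) = \sum_i A i j *: b i & t = \tr A]]%classic.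

End Trace.

(* The regular module R^o is what gives {ffun X -> R^o} its R-module structure.
   Coordinates move by g^-1, so that basis vectors move by g. *)
Section PermutationLattice.
Variables (R : comNzRingType) (X : finType).

Definition perm_basis (w : X) : {ffun X -> R^o} := [ffun v => (v == w)%:R].

Definition perm_act (g : {perm X}) (v : {ffun X -> R^o}) : {ffun X -> R^o} :=
  [ffun w => v (g^-1%g w)].

Lemma perm_act_basis g w : perm_act g (perm_basis w) = perm_basis (g w).
Proof.
by apply/ffunP=> v; rewrite !ffunE -(inj_eq (@perm_inj _ g)) permKV.
Qed.

Lemma perm_act_linear g : linear (perm_act g).
Proof. by move=> a u v; apply/ffunP=> w; rewrite !ffunE. Qed.

HB.instance Definition _ g := GRing.isLinear.Build R _ _ _ (perm_act g)
  (perm_act_linear g).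

(* The principal submatrix on F of the matrix of E in the basis perm_basis. *)
Definition principal_submx (E : {ffun X -> R^o} -> {ffun X -> R^o}) (F : {set X}) :
    'M[R]_#|F| :=
  \matrix_(i, j) E (perm_basis (enum_val j)) (enum_val i).

End PermutationLattice.

(* Main.v *)
Require Import Defs.
From mathcomp Require Import all_boot all_order all_algebra all_fingroup.
From mathcomp Require Import fraction boolp.
From mathcomp Require classical_sets.

(** Write M = O^X, G = <x>, F for the set of fixed points of x, kappa for the
residue field of O and e for E modulo its maximal ideal m. The trace of x on EM
can be read off from an O-basis of EM that x permutes: it is the number of fixed
basis vectors.
So it is enough to find a basis (b_w) of M with x b_w = b_(x w), each b_w lying
either in EM or in (1 - E)M, such that exactly rank(e[F]) of the b_w with w in F
lie in EM.

The G-maps u : M -> M, e_w |-> b_w correspond to the families with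
x b_w = b_(x w): such a family is given by an x-invariant vector for each fixed
point and an arbitrary vector for a representative of each other orbit
(x has prime order, so it acts freely off F). Everything then happens modulo m,
on V = kappa^X.

- u is invertible as soon as u mod m is, its determinant being then a unit.
  Moreover (x - 1)^p = x^p - 1 = 0 on V, so the kernel of u mod m, if nonzero,
  contains a nonzero x-invariant vector [unitmx_commute_nilpotent]. Hence only
  the action of u on V^G matters.
- V^G has a basis made of the e_w, w in F, and of the sums over the free
  orbits. In characteristic p, a sum over X of an x-invariant function only sees
  F [sum_invariant]. So u acts on V^G block-triangularly, with one block on F and
  one block on the free orbits, and both blocks are multiplicative in u
  [equivariant_unitmx]. In particular both blocks of e are idempotent
  [fixed_block_idempotent, free_reps_block_idempotent]; the first one is e[F].
- Over the field kappa, an idempotent matrix is conjugate to a diagonal matrix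
  with entries 0 and 1, as many entries 1 as its rank [idempotent_diag]. Lift to O
  the columns of the two conjugating matrices, and apply E to the columns whose
  diagonal entry is 1, and 1 - E to the others. This yields the b_w
  [adapted_basis]: modulo m, the two blocks of u are still the conjugating
  matrices, because the projections act on these columns as the identity.

What remains is linear algebra: the trace does not depend on the basis
[lin_traceE], and an O-basis of EM gives a basis of its scalar extension
[base_change_basis]. *)

Set Implicit Arguments.
Unset Strict Implicit.
Unset Printing Implicit Defensive.

Import GRing.Theory.
Local Open Scope ring_scope.

(** * Orbits of a permutation of prime order *)

Section Orbits.
Variables (X : finType) (x : {perm X}).
Hypothesis prime_x : prime #[x]%g.
Notation G := (<[x]>%g).

Lemma cycle_invariant (T : Type) (f : X -> T) :
  (forall w, f (x w) = f w) -> forall g, g \in G -> forall w, f (g w) = f w.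
Proof.
move=> fx _ /cycleP[k ->] w; rewrite permX.
by elim: k => //= k IHk; rewrite fx.
Qed.

Lemma cycle_fix g w : g \in G -> x w = w -> g w = w.
Proof.
move=> /cycleP[k ->] xw; rewrite permX.
by elim: k => //= k ->.
Qed.

Lemma cycle_moved g w : g \in G -> (x (g w) == g w) = (x w == w).
Proof.
move=> gG; have xg : x (g w) = g (x w).
  rewrite -!permM; congr (fun_of_perm _ w).
  by apply: (centsP (cycle_abelian x)) => //; apply: cycle_id.
by rewrite xg (inj_eq perm_inj).
Qed.

(** A nontrivial power of x generates the same group as x, because the order is
prime; so it cannot fix a point that x moves. *)
Lemma cycle_free w : x w != w -> {in G &, injective (fun g : {perm X} => g w)}.
Proof.
move=> xw; suff fr g : g \in G -> g w = w -> g = 1%g.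
  move=> g h gG hG /= gh; apply/eqP; rewrite eq_mulgV1; apply/eqP/fr.
    by rewrite groupM ?groupV.
  by rewrite permM gh permK.
move=> gG gw; apply/eqP; apply: contraNT xw => g1.
have og : #[g]%g = #[x]%g.
  have dv : (#[g]%g %| #[x]%g)%N by rewrite !orderE cardSg ?cycle_subG.
  have n1 : #[g]%g != 1%N by rewrite order_eq1.
  exact/(prime_nt_dvdP prime_x n1).
have /cycleP[k ->] : x \in <[g]>%g.
  have /eqP-> : <[g]>%g == G by rewrite eqEcard cycle_subG gG -!orderE og leqnn.
  exact: cycle_id.
by rewrite permX; apply/eqP; elim: k => //= k ->.
Qed.

Definition orbit_rep w : X := odflt w [pick u in porbit x w].

Lemma mem_orbit_rep w : orbit_rep w \in porbit x w.
Proof.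
by rewrite /orbit_rep; case: pickP => [u //|/(_ w)]; rewrite porbit_id.
Qed.

Lemma orbit_rep_mem u w : u \in porbit x w -> orbit_rep u = orbit_rep w.
Proof.
rewrite -eq_porbit_mem /orbit_rep => /eqP->.
by case: pickP => // /(_ w); rewrite porbit_id.
Qed.

Lemma orbit_rep_act g w : g \in G -> orbit_rep (g w) = orbit_rep w.
Proof. by case/cycleP=> k ->; apply: orbit_rep_mem; apply: mem_porbit. Qed.

Lemma orbit_rep_id w : orbit_rep (orbit_rep w) = orbit_rep w.
Proof. exact/orbit_rep_mem/mem_orbit_rep. Qed.

Lemma orbit_rep_ex w : exists2 g, g \in G & g (orbit_rep w) = w.
Proof.
have /porbitP[k ->] := mem_orbit_rep w.
exists ((x ^+ k)^-1)%g; last by rewrite permK.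
by rewrite groupV mem_cycle.
Qed.

(** The element is unique off the fixed points, where the action is free. At a
fixed point it is an arbitrary element of the group. *)
Definition to_rep w : {perm X} := odflt 1%g [pick g in G | g (orbit_rep w) == w].

Lemma to_repP w : to_rep w \in G /\ to_rep w (orbit_rep w) = w.
Proof.
rewrite /to_rep; case: pickP => [g /andP[gG /eqP gw] //|none].
by have [g gG gw] := orbit_rep_ex w; have := none g; rewrite gG gw eqxx.
Qed.

Definition fixed_points : {set X} := [set w | x w == w].
(** Since x has prime order, the orbits of these points are the free ones. *)
Definition free_reps : {set X} := [set w | (x w != w) && (orbit_rep w == w)].

Lemma orbit_rep_fixed w : w \in fixed_points -> orbit_rep w = w.
Proof.
rewrite inE => /eqP xw; have /porbitP[k ->] := mem_orbit_rep w.
by apply: cycle_fix => //; apply: mem_cycle.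
Qed.

Lemma reps_act_inj g s :
  g \in G -> s \in free_reps -> g s \in free_reps -> g = 1%g.
Proof.
move=> gG; rewrite !inE => /andP[xs /eqP rs] /andP[_].
rewrite orbit_rep_act // rs => /eqP gs.
by apply: (cycle_free xs); rewrite ?group1 // perm1.
Qed.

Lemma sum_moved (V : nmodType) (f : X -> V) :
  \sum_(w | w \notin fixed_points) f w =
    \sum_(s in free_reps) \sum_(g in G) f (g s).
Proof.
rewrite (partition_big orbit_rep (mem free_reps)) /=; last first.
  move=> w; rewrite !inE orbit_rep_id eqxx andbT.
  by have [gG gw] := to_repP w; rewrite -(cycle_moved (orbit_rep w) gG) gw.
apply: eq_bigr => s; rewrite inE => /andP[xs /eqP rs].
rewrite -(big_imset f (cycle_free xs)); apply: eq_bigl => w.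
rewrite inE; apply/andP/imsetP=> [[_ /eqP <-]|[g gG ->]].
  by have [gG gw] := to_repP w; exists (to_rep w).
by rewrite cycle_moved // orbit_rep_act // rs.
Qed.

Lemma sum_cycle_pchar (F : nzSemiRingType) (c : F) :
  #[x]%g \in [pchar F] -> \sum_(g in G) c = 0.
Proof. by move=> pF; rewrite sumr_const -orderE mulrn_pchar. Qed.

(** Free orbits contribute a multiple of p. *)
Lemma sum_invariant (F : nzSemiRingType) (f : X -> F) :
  #[x]%g \in [pchar F] -> (forall w, f (x w) = f w) ->
  \sum_w f w = \sum_(w in fixed_points) f w.
Proof.
move=> pF fx; rewrite (bigID (mem fixed_points)) /= sum_moved.
rewrite [X in _ + X]big1 ?addr0 // => s _.
under eq_bigr => g gG do rewrite (cycle_invariant fx gG).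
exact: sum_cycle_pchar.
Qed.

End Orbits.

(** * Diagonalisation of idempotent matrices *)

(** Gaussian elimination e = L P K, with P = diag(1, 0), shows that e is conjugate
through L to Q = P K L. As e is idempotent, Q P = P and P Q = Q: the idempotents
P and Q have the same column space. Then Z = Q - P has square 0, and 1 - Z
conjugates P into Q. *)
Lemma idempotent_similar_pid (F : fieldType) n (e : 'M[F]_n) :
  e *m e = e ->
  exists2 h, h \in unitmx & e *m h = h *m pid_mx (\rank e).
Proof.
move=> ee; set P : 'M_n := pid_mx _; set L := col_ebase e.
set K := row_ebase e.
have eE : e = L *m P *m K by rewrite mulmx_ebase.
have [uL uK] : L \in unitmx /\ K \in unitmx.
  by rewrite col_ebase_unit row_ebase_unit.
have PP : P *m P = P by rewrite pid_mx_id // rank_leq_row.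
pose Q := P *m (K *m L).
have PQ : P *m Q = Q by rewrite mulmxA PP.
have QP : Q *m P = P.
  have : invmx L *m (e *m e) *m invmx K = invmx L *m e *m invmx K by rewrite ee.
  by rewrite eE !mulmxA mulVmx // !mul1mx !(mulmxK uK) /Q !mulmxA.
have QQ : Q *m Q = Q by rewrite {2}/Q mulmxA QP.
pose Z := Q - P.
have ZP : Z *m P = 0 by rewrite mulmxBl QP PP subrr.
have QZ : Q *m Z = Q - P by rewrite mulmxBr QQ QP.
have ZZ : Z *m Z = 0 by rewrite {1}/Z mulmxBl QZ mulmxBr PQ PP subrr.
have uZ : 1%:M - Z \in unitmx.
  suff : (1%:M - Z) *m (1%:M + Z) = 1%:M by case/mulmx1_unit.
  by rewrite mulmxDr mulmx1 mulmxBl mul1mx ZZ subr0 subrK.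
exists (L *m (1%:M - Z)); first by rewrite unitmx_mul uL.
rewrite -[RHS]mulmxA mulmxBl mul1mx ZP subr0.
have -> : L *m P = L *m (Q *m (1%:M - Z)).
  by rewrite mulmxBr mulmx1 QZ opprB addrC subrK.
by rewrite eE /Q !mulmxA.
Qed.

(** The same for a block of e indexed by a subset of X, to be used for the fixed
points and for the free orbits. The injectivity clause expresses that h,
restricted to S, is invertible. *)
Lemma idempotent_diag (F : fieldType) (X : finType) (S : {set X})
    (e : X -> X -> F) :
  {in S &, forall i j, \sum_(k in S) e i k * e k j = e i j} ->
  exists (h : X -> X -> F) (D : {set X}),
  [/\ {in S &, forall i j, \sum_(k in S) e i k * h k j = (j \in D)%:R * h i j},
      forall c, {in S, forall i, \sum_(j in S) h i j * c j = 0} ->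
        {in S, forall j, c j = 0},
      D \subset S &
      #|D| = \rank (\matrix_(i < #|S|, j < #|S|) e (enum_val i) (enum_val j))].
Proof.
move=> ee; have [->|[s0 s0S]] := set_0Vmem S.
  exists (fun _ _ => 0), set0; split=> [i j|c _ j|//|].
  - by rewrite inE.
  - by rewrite inE.
  apply/eqP; rewrite eqn_leq rank_leq_row andbT.
  by rewrite [X in (X <= _)%N](@cards0 X).
set M := \matrix_(i, j) _; pose r := enum_rank_in s0S.
have MM : M *m M = M.
  apply/matrixP=> i j; rewrite !mxE -ee ?enum_valP // [RHS]big_enum_val.
  by apply: eq_bigr => k _; rewrite !mxE.
have [h uh eh] := idempotent_similar_pid MM.
exists (fun i j => h (r i) (r j)), [set j in S | (r j < \rank M)%N].
have rK i : r (enum_val i) = i by rewrite /r enum_valK_in.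
have Kr i : i \in S -> enum_val (r i) = i.
  by move=> iS; rewrite /r enum_rankK_in.
split.
- move=> i j iS jS; have /matrixP/(_ (r i) (r j)) := eh.
  rewrite !mxE inE jS /= => eq_ij; rewrite big_enum_val /=.
  transitivity (\sum_j0 M (r i) j0 * h j0 (r j)).
    by apply: eq_bigr => k _; rewrite !mxE rK Kr.
  rewrite eq_ij (bigD1 (r j)) //= mxE eqxx big1 ?addr0 => [|k kj].
    by rewrite mulrC.
  by rewrite mxE -val_eqE in kj *; rewrite (negPf kj) mulr0.
- move=> c hc j jS; pose v : 'cV_#|S| := \col_k c (enum_val k).
  have /matrixP/(_ (r j) 0) : v = 0.
    have hv : h *m v = 0.
      apply/matrixP=> i o; rewrite !mxE -[RHS](hc (enum_val i)) ?enum_valP //.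
      by rewrite [RHS]big_enum_val /=; apply: eq_bigr => k _; rewrite !mxE !rK.
    by rewrite -(mulKmx uh v) hv mulmx0.
  by rewrite !mxE Kr.
- by apply/subsetP=> j; rewrite inE => /andP[].
have le_rk : (\rank M <= #|S|)%N := rank_leq_row M.
rewrite -sum1_card (eq_bigl (fun j => (j \in S) && (r j < \rank M)%N)) => [|j].
  rewrite big_mkcondr big_enum_val /= -big_mkcond /=.
  under eq_bigl => k do rewrite rK.
  by rewrite (big_ord_narrow le_rk) sum1_card card_ord.
by rewrite inE.
Qed.

(** * Units among matrices commuting with a nilpotent one *)

(** The kernel of B is stable under t. If it is nonzero, the last nonzero power
of t on it lands in the kernel of t. *)
Lemma unitmx_commute_nilpotent (F : fieldType) n k (B t : 'M[F]_n) :
  B *m t = t *m B -> t ^+ k = 0 ->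
  (forall c : 'rV_n, c *m t = 0 -> c *m B = 0 -> c = 0) ->
  B \in unitmx.
Proof.
move=> Bt tk inj; rewrite unitmxE unitfE; apply/det0P => -[c /eqP c0 cB]; apply: c0.
have: c *m t ^+ k = 0 by rewrite tk mulmx0.
elim: k c cB {tk} => [|k IHk] c cB; first by rewrite expr0 mulmx1.
rewrite exprS mulmxA => ctk; apply: inj => //; apply: IHk => //.
by rewrite -mulmxA -Bt mulmxA cB mul0mx.
Qed.

(** * Traces, bases and extension of scalars *)

Section TraceBasis.
Variables (K : comNzRingType) (T : lmodType K).

Lemma is_basis_inj n (b : 'I_n -> T) (c d : 'rV_n) :
  is_basis b -> \sum_i c 0 i *: b i = \sum_i d 0 i *: b i -> c = d.
Proof.
move=> bb cd; have [a [_ ua]] := bb (\sum_i c 0 i *: b i).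
by rewrite -(ua c) // -(ua d).
Qed.

Lemma is_basis_coord n m (b : 'I_n -> T) (v : 'I_m -> T) : is_basis b ->
  exists A : 'M_(n, m), forall j, v j = \sum_i A i j *: b i.
Proof.
move=> bb.
have /choice[c hc] : forall j, exists c : 'rV_n, v j = \sum_i c 0 i *: b i.
  by move=> j; have [c [hc _]] := bb (v j); exists c.
by exists (\matrix_(i, j) c j 0 i) => j; under eq_bigr => i _ do rewrite mxE.
Qed.

Lemma sum_coord_mul n m l (b : 'I_n -> T) (A : 'M_(n, m)) (B : 'M_(m, l)) j :
  \sum_i B i j *: (\sum_k A k i *: b k) = \sum_k (A *m B) k j *: b k.
Proof.
under eq_bigr => i _ do rewrite scaler_sumr.
rewrite exchange_big; apply: eq_bigr => k _; rewrite mxE scaler_suml.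
by apply: eq_bigr => i _; rewrite scalerA mulrC.
Qed.

Lemma is_basis_mx_inj n m (b : 'I_n -> T) (A B : 'M_(n, m)) : is_basis b ->
  (forall j, \sum_i A i j *: b i = \sum_i B i j *: b i) -> A = B.
Proof.
move=> bb AB; apply/matrixP=> i j.
have /matrixP/(_ 0 i) : \row_i A i j = \row_i B i j; last by rewrite !mxE.
apply: (is_basis_inj bb).
under eq_bigr => k _ do rewrite mxE.
by under [RHS]eq_bigr => k _ do rewrite mxE.
Qed.

Lemma coord_mulmx n m (b : 'I_n -> T) (v : 'I_m -> T)
    (P : 'M_(n, m)) (Q : 'M_(m, n)) :
  is_basis b ->
  (forall j, v j = \sum_i P i j *: b i) ->
  (forall j, b j = \sum_i Q i j *: v i) -> P *m Q = 1%:M.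
Proof.
move=> bb hP hQ; apply: (is_basis_mx_inj bb) => j; rewrite -sum_coord_mul.
under eq_bigr => i _ do rewrite -hP.
rewrite -hQ (bigD1 j) //= mxE eqxx scale1r big1 ?addr0 // => i ij.
by rewrite mxE (negPf ij) scale0r.
Qed.

(** If P and Q are the base change matrices between two bases, then P Q = 1 and
Q P = 1, and tr A = tr (A P Q) = tr (P A' Q) = tr A'. The trace being cyclic on
rectangular products, the two sizes may a priori differ. *)
Lemma lin_traceE (f : {linear T -> T}) n (b : 'I_n -> T) (A : 'M_n) :
  is_basis b -> (forall j, f (b j) = \sum_i A i j *: b i) -> lin_trace f = \tr A.
Proof.
move=> bb fb; rewrite /lin_trace; case: classical_sets.xgetP => [t _|].
  case=> m [b' [A' [bb' fb' ->]]].
  have [P hP] := is_basis_coord b' bb.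
  have [Q hQ] := is_basis_coord b bb'.
  have AP : A *m P = P *m A'.
    apply: (is_basis_mx_inj bb) => j; rewrite -!sum_coord_mul.
    under [RHS]eq_bigr => i _ do rewrite -hP.
    rewrite -fb' hP linear_sum; apply: eq_bigr => i _.
    by rewrite linearZ /= fb.
  rewrite -[A]mulmx1 -(coord_mulmx bb hP hQ) mulmxA AP -mulmxA mxtrace_mulC.
  by rewrite -mulmxA (coord_mulmx bb' hQ hP) mulmx1.
by move=> /(_ (\tr A)) []; exists n, b, A.
Qed.

End TraceBasis.

Section BaseChangeBasis.
Variables (R K : comNzRingType) (phi : {rmorphism R -> K}) (L : lmodType R).

Lemma tensDr k : {morph tens phi k : u v / u + v : L >-> u + v}.
Proof. by move=> u v; rewrite /tens -tens_classD; apply/tens_classP/tens_Dr. Qed.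

Lemma tens0r k : tens phi k (0 : L) = 0.
Proof. exact/tens_classP/tens_0r. Qed.

Lemma tensZr k a (v : L) : tens phi k (a *: v) = (k * phi a) *: tens phi 1 v.
Proof.
rewrite -tens_classZ /tens_scale /= mulr1.
exact/esym/tens_classP/tens_Z.
Qed.

Lemma tens_sumr k I (r : seq I) (F : I -> L) :
  tens phi k (\sum_(i <- r) F i) = \sum_(i <- r) tens phi k (F i).
Proof. exact: (big_morph _ (tensDr k) (tens0r k)). Qed.

(** The universal property of the scalar extension; it is what separates its
elements, hence gives the uniqueness of coordinates in [base_change_basis]. *)
Lemma base_change_lift (f : L -> K) :
  {morph f : u v / u + v} -> (forall a v, f (a *: v) = phi a * f v) ->
  exists2 g : base_change phi L -> K,
    linear (g : base_change phi L -> K^o) & forall k v, g (tens phi k v) = k * f v.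
Proof.
move=> fD fZ; have f0 : f 0 = 0 by have := fZ 0 0; rewrite scale0r rmorph0 mul0r.
pose ev (s : seq (K * L)) := \sum_(x <- s) x.1 * f x.2.
have ev_rel s t : tens_rel phi s t -> ev s = ev t.
  rewrite /ev; elim=> {s t} //=.
  - by move=> s t u _ -> _ ->.
  - by move=> s s' t t' _ IHs _ IHt; rewrite !big_cat /= IHs IHt.
  - by move=> s t; rewrite !big_cat /= addrC.
  - by move=> k k' v; rewrite !big_cons big_nil !addr0 mulrDl.
  - by move=> k v v'; rewrite !big_cons big_nil !addr0 fD mulrDr.
  - by move=> v; rewrite big_seq1 big_nil mul0r.
  - by move=> k; rewrite big_seq1 big_nil f0 mulr0.
  - by move=> k a v; rewrite !big_seq1 fZ mulrA.
pose g (z : base_change phi L) := ev (generic_quotient.repr z).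
have gE s : g (tens_class phi s) = ev s by apply/ev_rel/tens_repr.
exists g => [k|k v]; last by rewrite gE /ev big_seq1.
elim/bc_ind=> s; elim/bc_ind=> t; rewrite -tens_classZ -tens_classD !gE.
rewrite /ev big_cat /= big_map scaler_sumr; congr (_ + _).
by apply: eq_bigr => -[k' v] _ /=; rewrite -mulrA.
Qed.

Lemma base_change_basis n (b : 'I_n -> L) :
  is_basis b -> is_basis (fun i => tens phi 1 (b i)).
Proof.
move=> bb; have /choice[c hc] : forall v, exists c : 'rV_n, v = \sum_i c 0 i *: b i.
  by move=> v; have [c [hc _]] := bb v; exists c.
have cD u v : c (u + v) = c u + c v.
  apply: (is_basis_inj bb); rewrite -hc {1}[u]hc {1}[v]hc -big_split.
  by apply: eq_bigr => i _; rewrite mxE scalerDl.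
have cZ a v : c (a *: v) = a *: c v.
  apply: (is_basis_inj bb); rewrite -hc {1}[v]hc scaler_sumr.
  by apply: eq_bigr => i _; rewrite mxE scalerA.
have cb i j : c (b j) 0 i = (i == j)%:R.
  transitivity ((delta_mx 0 j : 'rV[R]_n) 0 i); last by rewrite mxE eqxx.
  congr (fun_of_matrix _ _ _); apply: (is_basis_inj bb); rewrite -hc.
  rewrite (bigD1 j) //= mxE !eqxx scale1r big1 ?addr0 // => k kj.
  by rewrite mxE (negPf kj) scale0r.
have /choice[g hg] : forall i, exists g : base_change phi L -> K,
    linear (g : base_change phi L -> K^o) /\
    forall k v, g (tens phi k v) = k * phi (c v 0 i).
  move=> i; have [|a v|g gl gE] := @base_change_lift (fun v => phi (c v 0 i)).
  - by move=> u v; rewrite cD mxE rmorphD.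
  - by rewrite cZ mxE rmorphM.
  by exists g.
have gsum i (d : 'rV_n) : g i (\sum_j d 0 j *: tens phi 1 (b j)) = d 0 i.
  have [gl gE] := hg i.
  have gP a u v : g i (a *: u + v) = a * g i u + g i v by apply: gl.
  have gD u v : g i (u + v) = g i u + g i v.
    by have := gP 1 u v; rewrite scale1r mul1r.
  have g0 : g i 0 = 0 by apply: (addrI (g i 0)); rewrite -gD !addr0.
  have gZ a u : g i (a *: u) = a * g i u by have := gP a u 0; rewrite g0 !addr0.
  rewrite (big_morph (g i) gD g0) (bigD1 i) //= gZ gE cb eqxx rmorph1 !mulr1.
  rewrite big1 ?addr0 // => j ji.
  by rewrite gZ gE cb eq_sym (negPf ji) rmorph0 !mulr0.
move=> z; exists (\row_i g i z); split; last first.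
  by move=> d ->; apply/rowP=> i; rewrite mxE gsum.
suff [d ->] : exists d : 'rV_n, z = \sum_i d 0 i *: tens phi 1 (b i).
  by apply: eq_bigr => i _; rewrite mxE gsum.
elim/bc_ind: z => s; rewrite tens_classE.
exists (\row_i \sum_(x <- s) x.1 * phi (c x.2 0 i)).
under [RHS]eq_bigr => i _ do rewrite mxE scaler_suml.
rewrite exchange_big; apply: eq_bigr => -[k v] _ /=.
rewrite {1}[v]hc tens_sumr; apply: eq_bigr => i _; exact: tensZr.
Qed.

Lemma lin_trace_base_change (f : {linear L -> L}) n (b : 'I_n -> L) (A : 'M_n) :
  is_basis b -> (forall j, f (b j) = \sum_i A i j *: b i) ->
  lin_trace (base_change_map phi f) = phi (\tr A).
Proof.
move=> bb fb; rewrite (lin_traceE (A := map_mx phi A) (base_change_basis bb)).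
  by rewrite /mxtrace rmorph_sum; apply: eq_bigr => i _; rewrite mxE.
move=> j; rewrite /= base_change_map_tens fb tens_sumr; apply: eq_bigr => i _.
by rewrite tensZr mul1r mxE.
Qed.

End BaseChangeBasis.

(** * Equivariant matrices in characteristic p *)

Lemma sum_enum_val (V : nmodType) (X : finType) (f : X -> V) :
  \sum_(i < #|X|) f (enum_val i) = \sum_w f w.
Proof. by rewrite [RHS](reindex _ (onW_bij _ (@enum_val_bij X))). Qed.

(** Frobenius is additive on commuting elements. *)
Lemma unipotent_pchar (F : fieldType) n p (T : 'M[F]_n) :
  p \in [pchar F] -> T ^+ p = 1 -> (T - 1) ^+ p = 0.
Proof.
case: n T => [|n] T pF Tp; first by rewrite thinmx0 [RHS]thinmx0.
have pM : p \in [pchar 'M[F]_n.+1] by rewrite (pchar_lalg 'M[F]_n.+1).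
have := pFrobenius_autB_comm pM (commr1 T); rewrite !pFrobenius_autE => ->.
by rewrite Tp expr1n subrr.
Qed.

Section ModP.
Variables (X : finType) (x : {perm X}) (F : fieldType).
Hypotheses (prime_x : prime #[x]%g) (pF : #[x]%g \in [pchar F]).
Notation G := (<[x]>%g).

Section Blocks.
Variable e : X -> X -> F.
Hypothesis ee : forall i j, \sum_k e i k * e k j = e i j.
Hypothesis eG : forall g, g \in G -> forall i j, e (g i) (g j) = e i j.

Let xG : x \in G. Proof. exact: cycle_id. Qed.

(** For fixed i and j, the function k |-> e i k * e k j is x-invariant, so the free
orbits do not contribute to (e * e) i j. *)
Lemma fixed_block_idempotent :
  {in fixed_points x &,
    forall i j, \sum_(k in fixed_points x) e i k * e k j = e i j}.
Proof.
move=> i j; rewrite !inE => /eqP xi /eqP xj; rewrite -[RHS]ee; symmetry.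
apply: sum_invariant => // k.
by rewrite -{1}xi -{1}xj !(eG xG).
Qed.

(** The matrix e2 is that of e on the span of the free orbit sums: it gives the
coordinate at i of the image of the orbit sum of j. The terms of its square that
pass through a fixed point k cancel, as they come in p equal copies. *)
Lemma free_reps_block_idempotent :
  let e2 i j := \sum_(g in G) e (g i) j in
  {in free_reps x &, forall i j, \sum_(k in free_reps x) e2 i k * e2 k j = e2 i j}.
Proof.
move=> e2 i j _ _.
transitivity (\sum_(g in G) \sum_(k | k \notin fixed_points x) e (g i) k * e k j).
  rewrite [RHS]exchange_big sum_moved //; apply: eq_bigr => k _.
  rewrite mulr_sumr; apply: eq_bigr => h hG.
  rewrite mulr_suml [RHS](reindex_inj (mulIg h)) /=; apply: eq_big => g.
    by rewrite groupMr.
  by move=> _; rewrite permM eG.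
transitivity (\sum_(g in G) \sum_k e (g i) k * e k j); last first.
  by apply: eq_bigr => g _; rewrite ee.
under [RHS]eq_bigr => g _ do rewrite (bigID (mem (fixed_points x))) /=.
rewrite [RHS]big_split /= [X in X + _]exchange_big [X in X + _]big1 ?add0r // => k.
rewrite inE => /eqP xk.
rewrite (eq_bigr (fun _ => e i k * e k j)) ?sum_cycle_pchar // => g gG.
by rewrite -{1}(cycle_fix gG xk) eG.
Qed.

End Blocks.

(** An x-invariant vector d in the kernel is killed in two steps. Its coordinates
on the fixed points vanish by the first hypothesis, since only fixed points
contribute to sum_w b w v * d w when v is fixed; the remaining sum over the free
orbits is the system of the second hypothesis. *)
Lemma equivariant_unitmx (b : X -> X -> F) :
  (forall w v, b (x w) (x v) = b w v) ->
  (forall c, {in fixed_points x, forall v,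
       \sum_(w in fixed_points x) b w v * c w = 0} ->
    {in fixed_points x, forall w, c w = 0}) ->
  (forall c, {in free_reps x, forall v,
       \sum_(w in free_reps x) (\sum_(g in G) b w (g v)) * c w = 0} ->
    {in free_reps x, forall w, c w = 0}) ->
  \matrix_(i < #|X|, j < #|X|) b (enum_val i) (enum_val j) \in unitmx.
Proof.
move=> bx inj_fix inj_rep; set B := \matrix_(i, j) _.
pose T : 'M[F]_#|X| := \matrix_(i, j) (x (enum_val i) == enum_val j)%:R.
have bG g : g \in G -> forall w v, b (g w) (g v) = b w v.
  move=> /cycleP[k ->] w v; rewrite !permX.
  by elim: k => //= k IHk; rewrite bx.
have TX k : T ^+ k = \matrix_(i, j) ((x ^+ k)%g (enum_val i) == enum_val j)%:R.
  elim: k => [|k IHk].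
    by apply/matrixP=> i j; rewrite !mxE perm1 (inj_eq enum_val_inj).
  apply/matrixP=> i j; rewrite exprSr IHk !mxE expgSr permM.
  under eq_bigr => l _ do rewrite !mxE.
  rewrite (sum_enum_val (fun u => ((x ^+ k)%g (enum_val i) == u)%:R *
     (x u == enum_val j)%:R)).
  rewrite (bigD1 ((x ^+ k)%g (enum_val i))) //= eqxx mul1r big1 ?addr0 // => u.
  by rewrite eq_sym => /negPf->; rewrite mul0r.
have Tp : (T - 1) ^+ #[x]%g = 0.
  apply: unipotent_pchar => //; rewrite TX expg_order; apply/matrixP=> i j.
  by rewrite !mxE perm1 (inj_eq enum_val_inj).
have BT : B *m (T - 1) = (T - 1) *m B.
  rewrite mulmxBr mulmxBl mulmx1 mul1mx; congr (_ - _); apply/matrixP=> i j.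
  rewrite !mxE; set w := enum_val i; set v := enum_val j.
  under eq_bigr => l _ do rewrite !mxE.
  under [RHS]eq_bigr => l _ do rewrite !mxE.
  rewrite (sum_enum_val (fun u => b w u * (x u == v)%:R)).
  rewrite (sum_enum_val (fun u => (x w == u)%:R * b u v)).
  rewrite [RHS](bigD1 (x w)) //= eqxx mul1r.
  rewrite [X in _ = _ + X]big1 ?addr0 => [|u]; last first.
    by rewrite eq_sym => /negPf->; rewrite mul0r.
  rewrite (bigD1 (x^-1%g v)) //= permKV eqxx mulr1 big1 ?addr0 => [|u].
    by rewrite -{2}(permKV x v) bx.
  by rewrite -(inj_eq (@perm_inj _ x)) permKV => /negPf->; rewrite mulr0.
apply: (unitmx_commute_nilpotent BT Tp) => c cT cB.
pose d w := c 0 (enum_rank w).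
have dx w : d (x w) = d w.
  have /rowP/(_ (enum_rank (x w))) : c *m T = c.
    by apply/eqP; rewrite -subr_eq0 -{2}[c]mulmx1 -mulmxBr cT.
  rewrite mxE /d => <-; rewrite (bigD1 (enum_rank w)) //= mxE !enum_rankK.
  rewrite eqxx mulr1 big1 ?addr0 // => l lw; rewrite mxE enum_rankK.
  by rewrite (inj_eq perm_inj) -(inj_eq enum_rank_inj) enum_valK (negPf lw) mulr0.
have dB v : \sum_w b w v * d w = 0.
  transitivity ((c *m B) 0 (enum_rank v)); last by rewrite cB mxE.
  rewrite mxE -[LHS](sum_enum_val (fun w => b w v * d w)); apply: eq_bigr => i _.
  by rewrite mxE enum_rankK /d enum_valK mulrC.
have d_fix : {in fixed_points x, forall w, d w = 0}.
  apply: inj_fix => v; rewrite inE => /eqP xv; rewrite -[RHS](dB v).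
  by rewrite (sum_invariant prime_x pF) // => w; rewrite dx -{1}xv bx.
have d_rep : {in free_reps x, forall w, d w = 0}.
  apply: inj_rep => v _; rewrite -[RHS](dB v) [RHS](bigID (mem (fixed_points x))) /=.
  rewrite [X in _ = X + _]big1 ?add0r => [|w wf]; last by rewrite d_fix ?mulr0.
  rewrite sum_moved //.
  apply: eq_bigr => w _; rewrite mulr_suml (reindex_inj invg_inj) /=.
  apply: eq_big => g; first by rewrite groupV.
  by rewrite groupV => gG; rewrite (cycle_invariant dx gG) -(bG g gG) permKV.
have d0 w : d w = 0.
  have [|wm] := boolP (w \in fixed_points x); first exact: d_fix.
  have [gG <-] := to_repP x w; rewrite (cycle_invariant dx gG) d_rep //.
  rewrite inE orbit_rep_id eqxx andbT -(cycle_moved (orbit_rep x w) gG).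
  have [_ ->] := to_repP x w; by rewrite inE in wm.
by apply/rowP=> i; rewrite mxE -(enum_valK i) -/(d _) d0.
Qed.

End ModP.

(** * A permutation basis adapted to the idempotent *)

Section AdaptedBasis.
Variables (R : localRingType) (X : finType).

Lemma perm_basis_expand (f : {ffun X -> R^o}) :
  f = \sum_w f w *: Defs.perm_basis R w.
Proof.
apply/ffunP=> v; rewrite sum_ffunE (bigD1 v) //= !ffunE eqxx big1 => [|u uv].
  by rewrite addr0 [RHS]mulr1.
by rewrite !ffunE eq_sym (negPf uv) scaler0.
Qed.

Lemma linear_ffunE (E : {linear {ffun X -> R^o} -> {ffun X -> R^o}}) f v :
  E f v = \sum_w E (Defs.perm_basis R w) v * f w.
Proof.
rewrite {1}[f]perm_basis_expand linear_sum sum_ffunE; apply: eq_bigr => w _.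
by rewrite linearZ ffunE /= mulrC.
Qed.

Lemma perm_actM g h (v : {ffun X -> R^o}) :
  perm_act (g * h)%g v = perm_act h (perm_act g v).
Proof. by apply/ffunP=> w; rewrite !ffunE invMg permM. Qed.

Lemma perm_act1 (v : {ffun X -> R^o}) : perm_act 1%g v = v.
Proof. by apply/ffunP=> w; rewrite !ffunE invg1 perm1. Qed.

(** Nakayama for square matrices. *)
Lemma unitmx_residue n (B : 'M[R]_n) :
  map_mx (@residue R) B \in unitmx -> B \in unitmx.
Proof.
by rewrite !unitmxE unitfE det_map_mx residue_eq0 max_idealE negbK.
Qed.

Variables (x : {perm X}) (E : {linear {ffun X -> R^o} -> {ffun X -> R^o}}).
Hypotheses (prime_x : prime #[x]%g) (pR : #[x]%g \in [pchar residue_field R]).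
Notation G := (<[x]>%g).
Hypotheses (idemE : forall v, E (E v) = E v).
Hypothesis commE : forall g, g \in G ->
  forall v, E (perm_act g v) = perm_act g (E v).

Let e v w : residue_field R := residue (E (Defs.perm_basis R w) v).

Let ee i j : \sum_k e i k * e k j = e i j.
Proof.
rewrite /e -[in RHS]idemE [in RHS]linear_ffunE rmorph_sum.
by apply: eq_bigr => k _; rewrite rmorphM.
Qed.

Let eG g : g \in G -> forall i j, e (g i) (g j) = e i j.
Proof.
by move=> gG i j; rewrite /e -perm_act_basis commE // ffunE permK.
Qed.

(** The vectors b w with w in D form a basis of the image of E, the others one of
the image of 1 - E. *)
Lemma adapted_basis : exists (b : X -> {ffun X -> R^o}) (D : {set X}),
  [/\ forall w, b (x w) = perm_act x (b w),
      forall w, (x w \in D) = (w \in D),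
      forall w, E (b w) = if w \in D then b w else 0,
      \matrix_(i < #|X|, j < #|X|) (b (enum_val i) (enum_val j) : R) \in unitmx &
      #|D :&: fixed_points x| =
        \rank (map_mx (@residue R) (principal_submx E (fixed_points x)))].
Proof.
have [h1 [D1 [eh1 inj1 sD1 rk1]]] :=
  idempotent_diag (fixed_block_idempotent prime_x pR ee eG).
have [h2 [D2 [eh2 inj2 sD2 _]]] :=
  idempotent_diag (free_reps_block_idempotent prime_x pR ee eG).
have xG : x \in G by exact: cycle_id.
have reps_fixed w : w \in free_reps x -> w \in fixed_points x = false.
  by rewrite !inE => /andP[/negPf].
pose D0 := D1 :|: D2.
have D0fix w : w \in fixed_points x -> (w \in D0) = (w \in D1).
  move=> wf; rewrite inE orbC; case: (boolP (w \in D2)) => // wD2.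
  by rewrite (reps_fixed w) // in wf; apply: (subsetP sD2).
have D0rep w : w \in free_reps x -> (w \in D0) = (w \in D2).
  move=> wr; rewrite inE; case: (boolP (w \in D1)) => // wD1.
  by have := subsetP sD1 _ wD1; rewrite reps_fixed.
(* hh is block diagonal, with the two conjugating matrices as blocks; z lifts its
   columns, y projects them to the image of E or of 1 - E, and b spreads y along
   the orbits. *)
pose hh v w :=
  if w \in fixed_points x then (if v \in fixed_points x then h1 v w else 0)
  else (if v \in free_reps x then h2 v w else 0).
pose z w : {ffun X -> R^o} := [ffun v => generic_quotient.repr (hh v w)].
pose y w := if w \in D0 then E (z w) else z w - E (z w).
pose b w := perm_act (to_rep x w) (y (orbit_rep x w)).
have zE w v : residue (z w v) = hh v w by rewrite ffunE residueK.
have EzE w v : residue (E (z w) v) = \sum_u e v u * hh u w.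
  by rewrite linear_ffunE rmorph_sum; apply: eq_bigr => u _; rewrite rmorphM /= zE.
(* This makes b equivariant at the fixed points, where to_rep is arbitrary. *)
have y_inv w g : w \in fixed_points x -> g \in G -> perm_act g (y w) = y w.
  move=> wf gG; have zg : perm_act g (z w) = z w.
    apply/ffunP=> v; rewrite !ffunE /hh wf; congr generic_quotient.repr.
    have -> : (g^-1%g v \in fixed_points x) = (v \in fixed_points x).
      by rewrite !inE cycle_moved ?groupV.
    case: ifP => //; rewrite inE => /eqP xv.
    by rewrite (cycle_fix _ xv) ?groupV.
  by rewrite /y; case: ifP => _; rewrite ?linearB /= -?commE // zg.
have b_fix w : w \in fixed_points x -> b w = y w.
  move=> wf; have [gG _] := to_repP x w.
  by rewrite /b (orbit_rep_fixed wf) y_inv.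
have b_rep w : w \in free_reps x -> b w = y w.
  rewrite inE => /andP[xw /eqP rw]; have [gG gw] := to_repP x w.
  rewrite /b rw in gw *; have -> : to_rep x w = 1%g; last exact: perm_act1.
  by apply: (cycle_free prime_x xw); rewrite ?group1 // perm1.
have bx w : b (x w) = perm_act x (b w).
  have [|wm] := boolP (w \in fixed_points x).
    by move=> wf; move: (wf); rewrite inE => /eqP->; rewrite b_fix // y_inv.
  have rx : orbit_rep x (x w) = orbit_rep x w by apply: orbit_rep_act.
  have [gG gw] := to_repP x w; have [hG hw] := to_repP x (x w).
  have rm : x (orbit_rep x w) != orbit_rep x w.
    by rewrite -(cycle_moved _ gG) gw; rewrite inE in wm.
  rewrite /b -perm_actM rx; congr (perm_act _ _).
  apply: (cycle_free prime_x rm); rewrite ?groupM //.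
  by rewrite permM gw -rx hw.
have b_coord w v : residue (b (x w) (x v)) = residue (b w v).
  by rewrite bx ffunE permK.
exists b, [set w | orbit_rep x w \in D0]; split=> //.
- by move=> w; rewrite !inE orbit_rep_act.
- move=> w; have [gG _] := to_repP x w; rewrite inE /b commE //.
  rewrite /y; case: ifP => _; first by rewrite idemE.
  by rewrite linearB /= idemE subrr linear0.
- apply: unitmx_residue.
  have -> : map_mx (@residue R) (\matrix_(i < #|X|, j < #|X|)
       (b (enum_val i) (enum_val j) : R)) =
     \matrix_(i, j) residue (b (enum_val i) (enum_val j)).
    by apply/matrixP=> i j; rewrite !mxE.
  apply: (equivariant_unitmx prime_x pR (b := fun w v => residue (b w v))) => //.
    move=> c hc; apply: inj1 => v vf; rewrite -[RHS](hc v vf).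
    apply: eq_bigr => w wf; congr (_ * _); rewrite b_fix // /y D0fix //.
    (* Applying e multiplies column w of h1 by 1 if w is in D1 and by 0 otherwise, so
       in both cases the projection used in y leaves this column unchanged. *)
    have Ez : residue (E (z w) v) = (w \in D1)%:R * h1 v w.
      rewrite EzE -eh1 // [RHS]big_mkcond; apply: eq_bigr => u _.
      by rewrite /hh wf; case: ifP => _; rewrite ?mulr0.
    case: (w \in D1) Ez => Ez; first by rewrite Ez mul1r.
    by rewrite !ffunE rmorphB /= Ez mul0r subr0 residueK /hh wf vf.
  move=> c hc; apply: inj2 => v vr; rewrite -[RHS](hc v vr).
  apply: eq_bigr => w wr; congr (_ * _); rewrite b_rep // /y D0rep //.
  (* The same on orbit sums, where z has block h2: the only point of the orbit of v
     that is a representative is v. *)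
  have Ez : \sum_(g in G) residue (E (z w) (g v)) = (w \in D2)%:R * h2 v w.
    under eq_bigr => g _ do rewrite EzE.
    rewrite exchange_big -eh2 // [RHS]big_mkcond; apply: eq_bigr => u _.
    rewrite /hh reps_fixed //; case: ifP => _; first by rewrite mulr_suml.
    by rewrite big1 // => g _; rewrite mulr0.
  case: (w \in D2) Ez => Ez; first by rewrite Ez mul1r.
  transitivity (\sum_(g in G) (hh (g v) w - residue (E (z w) (g v)))).
    rewrite sumrB Ez mul0r subr0 (bigD1 1%g) ?group1 //= perm1 big1 ?addr0.
      by rewrite /hh reps_fixed // vr.
    move=> g /andP[gG g1]; rewrite /hh reps_fixed //; case: ifP => // gvr.
    by case/eqP: g1; apply: reps_act_inj gvr.
  by apply: eq_bigr => g _; rewrite !ffunE rmorphB /= residueK.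
have -> : [set w | orbit_rep x w \in D0] :&: fixed_points x = D1.
  apply/setP=> w; rewrite in_setI in_set; case: (boolP (w \in fixed_points x)) => wf.
    by rewrite andbT orbit_rep_fixed // D0fix.
  by rewrite andbF; apply/esym; apply: contraNF wf; apply: (subsetP sD1).
by rewrite rk1; congr (\rank _); apply/matrixP=> i j; rewrite !mxE.
Qed.

End AdaptedBasis.

(** * The trace on the image of the idempotent *)

Section UnitFamily.
Variables (R : comUnitRingType) (X : finType) (b : X -> {ffun X -> R^o}).
Hypothesis uB :
  \matrix_(i < #|X|, j < #|X|) (b (enum_val i) (enum_val j) : R) \in unitmx.

Lemma unitmx_family_gen f : exists a : X -> R, f = \sum_w a w *: b w.
Proof.
pose B := \matrix_(i < #|X|, j < #|X|) (b (enum_val i) (enum_val j) : R).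
pose u := \row_(j < #|X|) (f (enum_val j) : R); pose r := u *m invmx B.
exists (fun w => r 0 (enum_rank w)); apply/ffunP=> v; rewrite sum_ffunE.
transitivity ((r *m B) 0 (enum_rank v)).
  by rewrite mulmxKV // mxE enum_rankK.
rewrite mxE -[RHS]sum_enum_val.
by apply: eq_bigr => i _; rewrite ffunE [B _ _]mxE enum_rankK enum_valK.
Qed.

Lemma unitmx_family_free (a : X -> R) : \sum_w a w *: b w = 0 -> forall w, a w = 0.
Proof.
move=> ab0 w.
pose B := \matrix_(i < #|X|, j < #|X|) (b (enum_val i) (enum_val j) : R).
pose r := \row_(i < #|X|) a (enum_val i); have rB : r *m B = 0.
  apply/rowP=> j; rewrite !mxE.
  transitivity ((\sum_w a w *: b w) (enum_val j)); last by rewrite ab0 ffunE.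
  rewrite sum_ffunE -[RHS]sum_enum_val.
  by apply: eq_bigr => i _; rewrite !mxE ffunE.
have /rowP/(_ (enum_rank w)) : r = 0 by rewrite -(mulmxK uB r) rB mul0mx.
by rewrite !mxE enum_rankK.
Qed.

End UnitFamily.

Section Trace.
Variables (R : localRingType) (K : comNzRingType) (phi : {rmorphism R -> K}).
Variables (X : finType) (x : {perm X}).
Variable E : {linear {ffun X -> R^o} -> {ffun X -> R^o}}.
Hypothesis Ex : forall v, E (perm_act x v) = perm_act x (E v).
Hypothesis idemE : forall v, E (E v) = E v.
Variables (b : X -> {ffun X -> R^o}) (D : {set X}).
Hypothesis uB :
  \matrix_(i < #|X|, j < #|X|) (b (enum_val i) (enum_val j) : R) \in unitmx.
Hypothesis Eb : forall w, E (b w) = if w \in D then b w else 0.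
Hypothesis bx : forall w, b (x w) = perm_act x (b w).
Hypothesis Dx : forall w, (x w \in D) = (w \in D).

Lemma mem_lin_image (v : {ffun X -> R^o}) : E v \in lin_image_pred E.
Proof. by apply/asboolP; exists v. Qed.

(** The argument of LinImage is E (b w), which is b w for w in D; this form
makes membership in the image immediate. *)
Definition image_family (j : 'I_#|D|) : lin_image E :=
  LinImage (mem_lin_image (b (enum_val j))).

Lemma image_familyE j : val (image_family j) = b (enum_val j).
Proof. by rewrite /= Eb enum_valP. Qed.

Lemma val_sum_image_family (c : 'I_#|D| -> R) :
  val (\sum_i c i *: image_family i) = \sum_i c i *: b (enum_val i).
Proof. 
rewrite raddf_sum; apply: eq_bigr => i _.
by rewrite -image_familyE.
Qed.

Lemma image_family_basis : is_basis image_family.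
Proof.
move=> v; have idv : E (val v) = val v.
  by have /asboolP[u ->] := valP v; rewrite idemE.
have [a va] := unitmx_family_gen uB (val v).
have va' : v = \sum_i (\row_i a (enum_val i)) 0 i *: image_family i.
  apply: val_inj; rewrite val_sum_image_family -idv {1}va linear_sum.
  under [RHS]eq_bigr => i _ do rewrite mxE.
  rewrite -(big_enum_val (fun w => a w *: b w)) [RHS]big_mkcond.
  apply: eq_bigr => w _; rewrite linearZ /= Eb.
  by case: ifP => // _; rewrite scaler0.
exists (\row_i a (enum_val i)); split=> // c vc; apply/rowP=> i.
rewrite mxE; apply/eqP; rewrite -subr_eq0.
pose d w := \sum_(j < #|D| | enum_val j == w) (a (enum_val j) - c 0 j).
have : \sum_w d w *: b w = 0.
  transitivity (\sum_j (a (enum_val j) - c 0 j) *: b (enum_val j)).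
    rewrite [RHS](partition_big (fun j : 'I_#|D| => enum_val j) predT) //=.
    apply: eq_bigr => w _; rewrite scaler_suml.
    by apply: eq_bigr => j /eqP<-.
  under eq_bigr => j _ do rewrite scalerBl.
  rewrite sumrB; apply/eqP; rewrite subr_eq0 -!val_sum_image_family -vc.
  rewrite [in eqbRHS]va'; apply/eqP; congr val.
  by apply: eq_bigr => j _; rewrite mxE.
move/(unitmx_family_free uB)/(_ (enum_val i)); rewrite /d (big_pred1 i) => [->//|j].
by rewrite (inj_eq enum_val_inj).
Qed.

(** In the basis indexed by D, the matrix of x is that of its restriction to D as a
permutation. *)
Lemma lin_trace_image :
  lin_trace (base_change_map phi (lin_image_restr Ex)) = #|D :&: fixed_points x|%:R.
Proof.
pose A : 'M[R]_#|D| := \matrix_(i, j) (enum_val i == x (enum_val j))%:R.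
rewrite (lin_trace_base_change phi image_family_basis (A := A)) => [|j].
  rewrite -(rmorph_nat phi); congr (phi _); rewrite -[in RHS]sum1_card natr_sum.
  under [RHS]eq_bigl => w do rewrite in_setI.
  rewrite big_mkcondr big_enum_val; apply: eq_bigr => i _.
  by rewrite mxE inE eq_sym; case: ifP.
have xj : x (enum_val j) \in D by rewrite Dx enum_valP.
apply: val_inj; rewrite val_sum_image_family.
transitivity (b (x (enum_val j))); first by rewrite bx -image_familyE.
under eq_bigr => i _ do rewrite mxE.
rewrite -(big_enum_val (fun w => (w == x (enum_val j))%:R *: b w)).
rewrite (bigD1 (x (enum_val j))) //= eqxx scale1r big1 ?addr0 // => w.
by case/andP=> _ /negPf->; rewrite scale0r.
Qed.

End Trace.

Theorem theorem4p1 (p : nat) (p_prime : prime p)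
    (O : completeDVRType)
    (char_kappa : p \in [pchar (residue_field O)])
    (char_K : [pchar {fraction O}] =i pred0)
    (X : finType) (x : {perm X}) (order_x : #[x]%g = p)
    (E : {linear {ffun X -> O^o} -> {ffun X -> O^o}})
    (idemE : forall v, E (E v) = E v)
    (commE : forall g, g \in <[x]>%g ->
      forall v, E (perm_act g v) = perm_act g (E v)) :
  lin_trace (base_change_map (@FracField.tofrac O)
      (lin_image_restr (commE x (cycle_id x)))) =
  (\rank (map_mx (@residue O) (principal_submx E [set w | x w == w])))%:R.
Proof.
rewrite -order_x in p_prime char_kappa.
have [b [D [bx Dx Eb uB rkD]]] := adapted_basis p_prime char_kappa idemE commE.
by rewrite (lin_trace_image _ _ idemE uB Eb bx Dx) rkD.
Qed.
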